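(* Let $(L,[-,-])$ be a Leibniz algebra and let $D,D',D'',D''':L\to L$ be linear maps such that $$D''([x,y])=[D(x),y]+[x,D'(y)],\qquad D'''([x,y])=[D(x),y]+[x,D''(y)]$$ for all $x,y\in L$ (in particular $D$ is a generalized derivation of $(L,[-,-])$). Then $D$ is a generalized derivation of the ternary Leibniz algebra $\bar L=(L,\{x,y,z\}:=[x,[y,z]])$.
   Context: Vector spaces are over a field $\mathbb{K}$. A Leibniz algebra is a vector space $L$ with a bilinear map $[-,-]$ such that $[[x,y],z]=[x,[y,z]]+[[x,z],y]$ for all $x,y,z\in L$. For a Leibniz algebra $L$, the bracket $\{x,y,z\}=[x,[y,z]]$ makes $L$ a ternary Leibniz algebra $\bar L$, i.e. $\{\{x,y,z\},t,u\}=\{x,y,\{z,t,u\}\}+\{x,\{y,t,u\},z\}+\{\{x,t,u\},y,z\}$. A linear map $D$ on a Leibniz algebra is a generalized derivation if there exist linear maps $D',D''\in\mathrm{End}(L)$ with $D''([x,y])=[D(x),y]+[x,D'(y)]$ for all $x,y\in L$. A linear map $D$ on a ternary Leibniz algebra $(L,[-,-,-])$ is a generalized derivation if there exist linear maps $D_1,D_2,D_3\in\mathrm{End}(L)$ with $D_3([x,y,z])=[D(x),y,z]+[x,D_1(y),z]+[x,y,D_2(z)]$ for all $x,y,z\in L$. *)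

(* Defs.v *)
From mathcomp Require Import all_boot all_order all_algebra.

Set Implicit Arguments.
Unset Strict Implicit.
Unset Printing Implicit Defensive.

Import GRing.Theory.
Local Open Scope ring_scope.

(* Right Leibniz algebra structures on a K-vector space L of arbitrary,
   possibly infinite, dimension. *)
Record leibniz_algebra (K : fieldType) (L : lmodType K) := LeibnizAlgebra {
  leibniz_bracket :> {bilinear L -> L -> L};
  leibniz_identity : forall x y z : L,
    leibniz_bracket (leibniz_bracket x y) z =
      leibniz_bracket x (leibniz_bracket y z)
      + leibniz_bracket (leibniz_bracket x z) y
}.

Record ternary_leibniz_algebra (K : fieldType) (L : lmodType K) :=
  TernaryLeibnizAlgebra {
  ternary_bracket :> L -> L -> L -> L;
  ternary_linear1 : forall y z : L, linear (fun x => ternary_bracket x y z);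
  ternary_linear2 : forall x z : L, linear (fun y => ternary_bracket x y z);
  ternary_linear3 : forall x y : L, linear (fun z => ternary_bracket x y z);
  ternary_identity : forall x y z t u : L,
    ternary_bracket (ternary_bracket x y z) t u =
      ternary_bracket x y (ternary_bracket z t u)
      + ternary_bracket x (ternary_bracket y t u) z
      + ternary_bracket (ternary_bracket x t u) y z
}.

Section LeibnizBar.

Variables (K : fieldType) (L : lmodType K) (A : leibniz_algebra L).

Definition bar_bracket (x y z : L) : L := A x (A y z).

Fact bar_bracket_linear1 (y z : L) : linear (fun x => bar_bracket x y z).
Proof. by move=> a u v; rewrite /bar_bracket linearPl. Qed.

Fact bar_bracket_linear2 (x z : L) : linear (fun y => bar_bracket x y z).
Proof. by move=> a u v; rewrite /bar_bracket linearPl linearPr. Qed.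

Fact bar_bracket_linear3 (x y : L) : linear (fun z => bar_bracket x y z).
Proof. by move=> a u v; rewrite /bar_bracket !linearPr. Qed.

Fact bar_bracket_identity (x y z t u : L) :
  bar_bracket (bar_bracket x y z) t u =
    bar_bracket x y (bar_bracket z t u)
    + bar_bracket x (bar_bracket y t u) z
    + bar_bracket (bar_bracket x t u) y z.
Proof.
rewrite /bar_bracket leibniz_identity; congr (_ + _).
by rewrite leibniz_identity linearDr.
Qed.

Definition leibniz_bar : ternary_leibniz_algebra L :=
  TernaryLeibnizAlgebra bar_bracket_linear1 bar_bracket_linear2
    bar_bracket_linear3 bar_bracket_identity.

End LeibnizBar.

Definition generalized_derivation (K : fieldType) (L : lmodType K)
    (A : leibniz_algebra L) (D : {linear L -> L}) : Prop :=
  exists D' D'' : {linear L -> L},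
    forall x y : L, D'' (A x y) = A (D x) y + A x (D' y).

Definition ternary_generalized_derivation (K : fieldType) (L : lmodType K)
    (T : ternary_leibniz_algebra L) (D : {linear L -> L}) : Prop :=
  exists D1 D2 D3 : {linear L -> L},
    forall x y z : L, D3 (T x y z) = T (D x) y z + T x (D1 y) z + T x y (D2 z).

Fact generalized_derivation_intro (K : fieldType) (L : lmodType K)
    (A : leibniz_algebra L) (D D' D'' : {linear L -> L}) :
  (forall x y : L, D'' (A x y) = A (D x) y + A x (D' y)) ->
  generalized_derivation A D.
Proof. by move=> hD; exists D', D''. Qed.

(* Main.v *)
Require Import Defs.
From mathcomp Require Import all_boot all_order all_algebra.
Import GRing.Theory.
Local Open Scope ring_scope.

Theorem lemma3p2 (K : fieldType) (L : lmodType K) (A : leibniz_algebra L)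
    (D D' D'' D''' : {linear L -> L})
    (hD'' : forall x y : L, D'' (A x y) = A (D x) y + A x (D' y))
    (hD''' : forall x y : L, D''' (A x y) = A (D x) y + A x (D'' y)) :
  ternary_generalized_derivation (leibniz_bar A) D.
Proof.
(* As {x, y, z} = [x, [y, z]], the second identity moves D''' past the outer
   bracket, leaving D'' applied to [y, z], where the first identity applies:
   the second slot receives D again and the third one D'. *)
exists D, D', D''' => x y z /=.
by rewrite /bar_bracket hD''' hD'' linearDr addrA.
Qed.
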